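(* There is an absolute constant $C>0$ such that the following holds. Let $d,M,N\in\mathbb{N}$, let $\Gamma\subset\mathbb{Z}^d$ be finite with $D=|\Gamma|$, and let the random sampling set $X=(x_1,\dots,x_N)$ be chosen according to probability model (1) or probability model (2). Let $\tau,\epsilon\in(0,1)$ and $\sigma>0$. Assume that $$N\geq C\,\tau^{-2}(2M-1)^2\ln(4D'/\epsilon),$$ where $D'=\#\{j-k:\ j,k\in\Gamma,\ j\ne k\}\le D^2$. Then with probability at least $1-\epsilon$ the following holds for all $f\in\Pi_\Gamma(M)$ whose Fourier coefficients $c$ satisfy $$\min_{k\in\operatorname{supp}c}|c_k|>\frac{2\sigma}{(1-\tau)\sqrt N}.$$ If Orthogonal Matching Pursuit (OMP) is applied to the noisy samples $y=\mathcal{F}_Xc+\eta$ with $\|\eta\|_2\le\sigma$, and stopped once the residual satisfies $\|r_s\|_2\le\sigma$, then the true support of $c$ is recovered and the reconstructed coefficient vector $\tilde c$ satisfies $$\|c-\tilde c\|_2\le\frac{1}{\sqrt{N(1-\tau/2)}}\,\sigma .$$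
   Context: For a finite set $\Gamma\subset\mathbb{Z}^d$, $\Pi_\Gamma(M)$ is the set of trigonometric polynomials $f(x)=\sum_{k\in\Gamma}c_ke^{ik\cdot x}$, $x\in[0,2\pi]^d$, whose coefficient vector $c=(c_k)_{k\in\Gamma}\in\mathbb{C}^\Gamma$ is supported on some $T\subset\Gamma$ with $|T|\le M$; $\operatorname{supp}c=\{k\in\Gamma:c_k\neq0\}$. For sampling points $X=(x_1,\dots,x_N)$ in $[0,2\pi]^d$, $\mathcal{F}_X$ is the $N\times|\Gamma|$ matrix with entries $(\mathcal{F}_X)_{j,k}=e^{ik\cdot x_j}$, so that $f(x_j)=(\mathcal{F}_Xc)_j$. Its $k$-th column is denoted $\phi_k=(e^{ik\cdot x_\ell})_{\ell=1}^N$, and $\mathcal{F}_{TX}$ denotes its restriction to the columns indexed by $T\subset\Gamma$. Probability models. Model (1) (continuous): $x_1,\dots,x_N$ are independent random variables, each uniformly distributed on the cube $[0,2\pi]^d$. Model (2) (discrete): $x_1,\dots,x_N$ are independent random variables, each uniformly distributed on the grid $\{0,\frac{2\pi}{q},\dots,2\pi\frac{q-1}{q}\}^d$, where $q\in\mathbb{N}$ is such that $\Gamma\subseteq\{0,1,\dots,q-1\}^d$. OMP with input $y\in\mathbb{C}^N$: set $r_0=y$, $T_0=\emptyset$. In step $s=1,2,\dots$: choose $k_s\in\arg\max_{k\in\Gamma}|\langle r_{s-1},\phi_k\rangle|$; set $T_s=T_{s-1}\cup\{k_s\}$; let $d_s$ be a minimizer of $\|\mathcal{F}_{T_sX}d-y\|_2$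 over $d\in\mathbb{C}^{T_s}$; set $r_s=y-\mathcal{F}_{T_sX}d_s$ (the residual). When stopped at index $s$, the recovered support is $T_s$ and the reconstructed coefficient vector $\tilde c\in\mathbb{C}^\Gamma$ is equal to $d_s$ on $T_s$ and zero outside $T_s$. *)

(* Defs.v *)
From HB Require Import structures.
From mathcomp Require Import all_boot all_order all_algebra finmap.
From mathcomp Require Import complex.
From mathcomp Require Import all_classical all_reals all_analysis.

Set Implicit Arguments.
Unset Strict Implicit.
Unset Printing Implicit Defensive.

Import Order.TTheory GRing.Theory Num.Theory.

Local Open Scope ring_scope.

(* For a finite type I, the space C^I is {ffun I -> R[i]} with its pointwise
   vector space structure.  Frequencies are rows 'rV[int]_d and points of R^d
   are d.-tuple R, whose sigma-algebra is the product of the Borel ones. *)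

Section Vectors.
Context (R : realType) (I : finType).
Implicit Types u v : {ffun I -> R[i]}.

Definition cmod (z : R[i]) : R := Normc.normc z.

Definition l2norm v : R := Num.sqrt (\sum_i cmod (v i) ^+ 2).

Definition inner u v : R[i] := \sum_i u i * (v i)^*%C.

Definition supp v : {set I} := finset (fun k => v k != 0).

Definition zero_ext (T : {set I}) v : {ffun I -> R[i]} :=
  [ffun k => if k \in T then v k else 0].

End Vectors.

Section TrigonometricPolynomials.
Context (R : realType) (d : nat).

Definition dotp (k : 'rV[int]_d) (x : d.-tuple R) : R :=
  \sum_(i < d) (k ord0 i)%:~R * tnth x i.

Definition expi (t : R) : R[i] := (cos t +i* sin t)%C.

Definition in_cube (x : d.-tuple R) : Prop :=
  forall i, 0 <= tnth x i <= 2 * pi.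

Variable Gamma : {fset 'rV[int]_d}.

(* c is the coefficient vector of f, a member of Pi_Gamma(M). *)
Definition sparse_trigpoly (M : nat) (f : d.-tuple R -> R[i])
    (c : {ffun Gamma -> R[i]}) : Prop :=
  (exists T : {set Gamma}, (#|T| <= M)%N /\ supp c \subset T) /\
  forall x, in_cube x -> f x = \sum_(k : Gamma) c k * expi (dotp (val k) x).

Definition difference_set : {fset 'rV[int]_d} :=
  [fset j - k | j in Gamma, k in Gamma & j != k]%fset.

Lemma card_difference_set : (#|` difference_set| <= #|` Gamma| ^ 2)%N.
Proof.
rewrite -mulnn [#|` Gamma|]cardfE -card_prod cardE -(size_map (fun p => val p.1 - val p.2)).
apply: uniq_leq_size => // z /imfset2P[j jG [k]].
rewrite !inE => /andP[kG _] ->.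
by apply/mapP; exists ([` jG]%fset, [` kG]%fset); rewrite ?mem_enum.
Qed.

End TrigonometricPolynomials.

Section Sampling.
Context (R : realType) (d N : nat) (Gamma : {fset 'rV[int]_d}).
Variable x : 'I_N -> d.-tuple R.

Definition phi (k : Gamma) : {ffun 'I_N -> R[i]} :=
  [ffun l => expi (dotp (val k) (x l))].

(* The product of F_TX with the vector (c_k)_{k in T}: only the values of c on
   T matter, so c stands for an element of C^T. *)
Definition FT (T : {set Gamma}) (c : {ffun Gamma -> R[i]}) :
    {ffun 'I_N -> R[i]} :=
  \sum_(k in T) c k *: phi k.

Definition F (c : {ffun Gamma -> R[i]}) := FT [set: Gamma]%SET c.

Lemma F_sample M f c l : sparse_trigpoly M f c -> in_cube (x l) ->
  F c l = f (x l).
Proof.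
move=> [_ fE] xl; rewrite fE// /F /FT sum_ffunE.
by apply: eq_big => [k|k _]; rewrite ?inE// !ffunE.
Qed.

Definition is_argmax (r : {ffun 'I_N -> R[i]}) (k : Gamma) : Prop :=
  forall j : Gamma, cmod (inner r (phi j)) <= cmod (inner r (phi k)).

Definition is_least_squares (y : {ffun 'I_N -> R[i]}) (T : {set Gamma})
    (c : {ffun Gamma -> R[i]}) : Prop :=
  forall c', l2norm (FT T c - y) <= l2norm (FT T c' - y).

Definition omp_step (y : {ffun 'I_N -> R[i]}) (T : {set Gamma})
    (r : {ffun 'I_N -> R[i]}) (T' : {set Gamma}) (c' : {ffun Gamma -> R[i]})
    (r' : {ffun 'I_N -> R[i]}) : Prop :=
  [/\ exists2 k, is_argmax r k & T' = (k |: T)%SET,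
      is_least_squares y T' c' &
      r' = y - FT T' c'].

(* OMP with input y, stopped once the residual has norm at most sigma: the
   iterates are unconstrained after the stopping index, and so is c 0, since
   T 0 is empty.  Ties in the choice of k_s, and the choice of a minimizer, are
   resolved arbitrarily. *)
Definition omp_run (y : {ffun 'I_N -> R[i]}) (sigma : R)
    (T : nat -> {set Gamma}) (c : nat -> {ffun Gamma -> R[i]})
    (r : nat -> {ffun 'I_N -> R[i]}) : Prop :=
  [/\ T 0%N = finset.set0, r 0%N = y &
      forall s, (forall t, (t <= s)%N -> sigma < l2norm (r t)) ->
        omp_step y (T s) (r s) (T s.+1) (c s.+1) (r s.+1)].

Definition stops_at (sigma : R) (r : nat -> {ffun 'I_N -> R[i]}) (s : nat) :
    Prop :=
  l2norm (r s) <= sigma /\ forall t, (t < s)%N -> sigma < l2norm (r t).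

End Sampling.

Section ProbabilityModels.
Local Open Scope classical_set_scope.
Local Open Scope ereal_scope.
Context (disp : measure_display) (Omega : measurableType disp) (R : realType)
  (P : probability Omega R).

Definition independent_RVs (disp' : measure_display) (E : measurableType disp')
    (I : finType) (X : I -> {RV P >-> E}) : Prop :=
  forall (J : {set I}) (B : I -> set E), (forall i, measurable (B i)) ->
    P (\bigcap_(i in [set` J]) (X i @^-1` B i)) =
    \prod_(i in J) P (X i @^-1` B i).

Lemma two_pi_gt0 : (0 < 2 * pi :> R)%R.
Proof. by rewrite mulr_gt0 ?pi_gt0. Qed.

(* The uniform distribution on [0, 2 pi]^d is the product of d copies of the
   one on [0, 2 pi]; a product measure is given by its values on boxes. *)
Definition uniform_cube (d : nat) (x : {RV P >-> d.-tuple R}) : Prop :=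
  forall B : 'I_d -> set R, (forall i, measurable (B i)) ->
    P (x @^-1` [set z | forall i, B i (tnth z i)]) =
    \prod_(i < d) uniform_prob two_pi_gt0 (B i).

Definition grid_point (d q : nat) (m : d.-tuple 'I_q) : d.-tuple R :=
  [tuple (2 * pi * (tnth m i)%:R / q%:R)%R | i < d].

Definition uniform_grid (d q : nat) (x : {RV P >-> d.-tuple R}) : Prop :=
  forall m : d.-tuple 'I_q,
    P (x @^-1` [set grid_point m]) = ((q ^ d)%:R^-1)%:E.

Definition continuous_model (d N : nat) (X : 'I_N -> {RV P >-> d.-tuple R}) :
    Prop :=
  independent_RVs X /\ forall l, uniform_cube (X l).

Definition discrete_model (d N : nat) (Gamma : {fset 'rV[int]_d})
    (X : 'I_N -> {RV P >-> d.-tuple R}) : Prop :=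
  exists q : nat,
    [/\ (0 < q)%N,
        forall k, k \in Gamma -> forall i, (0 <= k ord0 i < q%:Z)%R,
        independent_RVs X &
        forall l, uniform_grid q (X l)].

(* No measurability of the event Q is presupposed. *)
Definition with_probability_at_least (p : R) (Q : set Omega) : Prop :=
  exists A : set Omega, [/\ measurable A, p%:E <= P A & A `<=` Q].

End ProbabilityModels.

(* Main.v *)
Require Import Defs.
From HB Require Import structures.
From mathcomp Require Import all_boot all_order all_algebra finmap.
From mathcomp Require Import complex ring lra.
From mathcomp Require Import all_classical all_reals all_analysis.

Import Order.TTheory GRing.Theory Num.Theory.
Import numFieldNormedType.Exports.

Local Open Scope ring_scope.

Set Implicit Arguments.
Unset Strict Implicit.
Unset Printing Implicit Defensive.

(** The proof separates a deterministic statement about one sampling set from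
    a count of the sampling sets to which it applies.

    Deterministically, suppose that distinct columns of the sampling matrix
    have inner products of modulus at most mu N, where (2 M - 1) mu <= tau. If
    T is a subset of the support S of c and b minimizes the residual over T,
    then the residual is F a + eta, where a is c minus b extended by zero; a
    is again supported in S and agrees with c off T. While T misses some
    frequency of S, a has a coefficient above the threshold on c. Then the
    residual is longer than sigma, since M columns are nearly orthogonal
    ([residual_large]), and the greedy choice is a new frequency of S, since
    its correlation with the residual beats what coherence and noise allow
    elsewhere ([greedy_choice]). So the run reaches S after #|S| steps and
    stops there, because c itself is a competitor with residual eta; the
    normal equations at that point give the error bound ([l2norm_err_le]).

    The inner product of columns j and k is the exponential sum of the points
    along j - k, so the coherence condition is a bound on D' exponential sums.
    This is a matter of counting. In the discrete model the points are N
    independent uniform points of the grid (Z/q)^d, and a probability is a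
    count of N-tuples of grid points divided by q^(dN). In the continuous
    model the same is true of the points rounded down to a grid with large q:
    the boxes of the grid are equally likely, and rounding changes the
    exponentials as little as one likes. On the grid, the four functions given
    by the sine and cosine of the phase with either sign have mean zero by
    orthogonality of characters ([grid_character_sum]), so Chernoff's bound in
    counting form ([chernoff_count]) and a union bound over the 4 D' sums show
    that at most a fraction epsilon of all tuples is bad
    ([exponential_sums_small]). *)

(** * Hermitian geometry of finite complex vectors *)

Section Hermitian.
Context (R : realType).
Implicit Types (x y z : R[i]).

Lemma cmod_ge0 z : 0 <= cmod z.
Proof. by case: z => a b; exact: sqrtr_ge0. Qed.

Lemma cmodE z : (cmod z)%:C%C = `|z|.
Proof. by []. Qed.

Lemma cmodM : {morph @cmod R : x y / x * y}.
Proof. exact: Normc.normcM. Qed.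

Lemma cmodD x y : cmod (x + y) <= cmod x + cmod y.
Proof. exact: le_normcD. Qed.

Lemma cmodN z : cmod (- z) = cmod z.
Proof. exact: normcN. Qed.

Lemma cmod0 : @cmod R 0 = 0.
Proof. exact: Normc.normc0. Qed.

Lemma cmod_conj z : cmod z^*%C = cmod z.
Proof. by case: z => a b; rewrite /cmod /= sqrrN. Qed.

Lemma cmod_eq0 z : (cmod z == 0) = (z == 0).
Proof. by apply/eqP/eqP => [/Normc.eq0_normc//|->]; exact: cmod0. Qed.

Lemma cmod_sum (I : finType) (A : pred I) (g : I -> R[i]) :
  cmod (\sum_(i | A i) g i) <= \sum_(i | A i) cmod (g i).
Proof.
elim/big_ind2 : _ => [|x a y b xa yb|//]; first by rewrite cmod0.
by rewrite (le_trans (cmodD a b))// lerD.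
Qed.

Lemma Re_le_cmod z : complex.Re z <= cmod z.
Proof.
case: z => a b; rewrite /cmod /=; apply: (le_trans (ler_norm _)).
by rewrite -sqrtr_sqr ler_wsqrtr// lerDl sqr_ge0.
Qed.

Lemma mul_conj z : z * z^*%C = ((cmod z) ^+ 2)%:C%C.
Proof. by rewrite rmorphXn /= cmodE sqr_normc. Qed.

Lemma cmod_real (a : R) : cmod (a%:C)%C = `|a|.
Proof. by rewrite /cmod /= expr0n /= addr0 sqrtr_sqr. Qed.

Context (I : finType).
Implicit Types (u v w : {ffun I -> R[i]}).

Lemma innerDl u v w : inner (u + v) w = inner u w + inner v w.
Proof.
by rewrite /inner -big_split /=; apply: eq_bigr => i _; rewrite ffunE mulrDl.
Qed.

Lemma innerZl a u w : inner (a *: u) w = a * inner u w.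
Proof.
by rewrite /inner mulr_sumr; apply: eq_bigr => i _; rewrite ffunE mulrA.
Qed.

Lemma innerC u v : inner v u = (inner u v)^*%C.
Proof.
rewrite /inner rmorph_sum /=; apply: eq_bigr => i _.
by rewrite rmorphM /= conjcK mulrC.
Qed.

Lemma innerDr w u v : inner w (u + v) = inner w u + inner w v.
Proof. by rewrite innerC innerDl rmorphD /= -!innerC. Qed.

Lemma innerZr a w u : inner w (a *: u) = a^*%C * inner w u.
Proof. by rewrite innerC innerZl rmorphM /= -innerC. Qed.

Lemma inner0l v : inner 0 v = 0.
Proof. by rewrite -(scale0r 0) innerZl mul0r. Qed.

Lemma inner_suml (J : finType) (A : pred J) (g : J -> {ffun I -> R[i]}) w :
  inner (\sum_(j | A j) g j) w = \sum_(j | A j) inner (g j) w.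
Proof.
elim/big_ind2 : _ => [|a u b v <- <-|//]; first by rewrite inner0l.
by rewrite innerDl.
Qed.

Lemma l2norm_ge0 v : 0 <= l2norm v.
Proof. exact: sqrtr_ge0. Qed.

Lemma l2norm_sqr v : l2norm v ^+ 2 = \sum_i cmod (v i) ^+ 2.
Proof. by rewrite sqr_sqrtr// sumr_ge0// => i _; rewrite sqr_ge0. Qed.

Lemma inner_self v : inner v v = (l2norm v ^+ 2)%:C%C.
Proof.
by rewrite l2norm_sqr rmorph_sum /=; apply: eq_bigr => i _; rewrite mul_conj.
Qed.

Lemma l2normD_sqr u v : l2norm (u + v) ^+ 2 =
  l2norm u ^+ 2 + l2norm v ^+ 2 + 2 * complex.Re (inner u v).
Proof.
have : complex.Re (inner (u + v) (u + v)) = l2norm (u + v) ^+ 2.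
  by rewrite inner_self.
move=> <-; rewrite innerDl !innerDr !inner_self (innerC u v).
by case: (inner u v) => a b /=; ring.
Qed.

Lemma l2normN v : l2norm (- v) = l2norm v.
Proof.
by congr Num.sqrt; apply: eq_bigr => i _; rewrite ffunE cmodN.
Qed.

Lemma l2norm_eq0 v : (l2norm v == 0) = (v == 0).
Proof.
apply/eqP/eqP => [v0|->]; last first.
  apply/eqP; rewrite -sqrf_eq0 l2norm_sqr big1// => i _.
  by rewrite ffunE cmod0 expr0n.
apply/ffunP => i; rewrite ffunE; apply/eqP; rewrite -cmod_eq0 -sqrf_eq0.
have := l2norm_sqr v; rewrite v0 expr0n /= => /esym/eqP.
by rewrite psumr_eq0 => [/allP/(_ i (mem_index_enum i))//|j _]; exact: sqr_ge0.
Qed.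

(** Pythagoras for the component of u along v: the identity behind both the
    Cauchy-Schwarz inequality and the normal equations. *)
Lemma l2norm_sub_component u v : v != 0 ->
  l2norm (u - (inner u v / (l2norm v ^+ 2)%:C%C) *: v) ^+ 2 =
  l2norm u ^+ 2 - cmod (inner u v) ^+ 2 / l2norm v ^+ 2.
Proof.
move=> v0; have n0 : l2norm v ^+ 2 != 0 by rewrite sqrf_eq0 l2norm_eq0.
rewrite -scaleNr l2normD_sqr innerZr.
set z := inner u v; set n := l2norm v ^+ 2.
have -> : l2norm (- (z / n%:C%C) *: v) ^+ 2 = cmod z ^+ 2 / n.
  have : inner (- (z / n%:C%C) *: v) (- (z / n%:C%C) *: v) = (cmod z ^+ 2 / n)%:C%C.
    rewrite innerZl innerZr inner_self -/n mulrA mul_conj cmodN cmodM.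
    rewrite -rmorphM; congr (_%:C)%C.
    rewrite [cmod _^-1]Normc.normcV -/(cmod _) cmod_real exprMn exprVn.
    by rewrite (real_normK (num_real _)); field.
  by rewrite inner_self => /complexI.
have -> : complex.Re ((- (z / n%:C%C))^*%C * z) = - (cmod z ^+ 2 / n).
  rewrite rmorphN mulNr rmorphM mulrAC [_^*%C * z]mulrC mul_conj.
  by rewrite -fmorphV [X in _ * X](conjc_real n^-1) -rmorphM.
by lra.
Qed.

Lemma CauchySchwarz u v : cmod (inner u v) <= l2norm u * l2norm v.
Proof.
have [->|v0] := eqVneq v 0.
  by rewrite innerC inner0l conjc0 cmod0 mulr_ge0// l2norm_ge0.
have n0 : 0 < l2norm v ^+ 2 by rewrite exprn_gt0// lt_def l2norm_eq0 v0 l2norm_ge0.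
rewrite -(@ler_pXn2r _ 2)// ?nnegrE ?mulr_ge0 ?cmod_ge0 ?l2norm_ge0//.
rewrite exprMn -ler_pdivrMr// -subr_ge0 -l2norm_sub_component//.
exact: sqr_ge0.
Qed.

Lemma l2normD u v : l2norm (u + v) <= l2norm u + l2norm v.
Proof.
rewrite -(@ler_pXn2r _ 2)// ?nnegrE ?addr_ge0 ?l2norm_ge0//.
rewrite l2normD_sqr sqrrD.
have := le_trans (Re_le_cmod _) (CauchySchwarz u v).
by lra.
Qed.
End Hermitian.

(** * Columns of the sampling matrix and least squares *)

Section Greedy.
Context (R : realType) (d N : nat) (Gamma : {fset 'rV[int]_d}).
Variable x : 'I_N -> d.-tuple R.
Implicit Types (a c : {ffun Gamma -> R[i]}) (v eta : {ffun 'I_N -> R[i]}).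

Lemma expiD (s t : R) : expi (s + t) = expi s * expi t.
Proof.
rewrite /expi cosD sinD; simpc; congr (_ +i* _)%C.
by rewrite addrC [sin s * _]mulrC.
Qed.

Lemma expiN (t : R) : expi (- t) = (expi t)^*%C.
Proof. by rewrite /expi cosN sinN. Qed.

Lemma expi0 : expi 0 = 1 :> R[i].
Proof. by rewrite /expi cos0 sin0. Qed.

Lemma dotpB (j k : 'rV[int]_d) (z : d.-tuple R) :
  dotp (j - k) z = dotp j z - dotp k z.
Proof.
rewrite /dotp -sumrB; apply: eq_bigr => i _.
by rewrite !mxE rmorphD rmorphN /= mulrDl mulNr.
Qed.

Lemma inner_phi (j k : Gamma) :
  inner (phi x j) (phi x k) = \sum_l expi (dotp (val j - val k) (x l)).
Proof.
by apply: eq_bigr => l _; rewrite !ffunE dotpB expiD expiN.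
Qed.

Lemma inner_phi_self (k : Gamma) : inner (phi x k) (phi x k) = N%:R.
Proof.
rewrite inner_phi; under eq_bigr do rewrite dotpB subrr expi0.
by rewrite sumr_const card_ord.
Qed.

Lemma l2norm_phi_sqr (k : Gamma) : l2norm (phi x k) ^+ 2 = N%:R.
Proof.
by apply: complexI; rewrite -inner_self inner_phi_self rmorph_nat.
Qed.

Lemma l2norm_phi (k : Gamma) : l2norm (phi x k) = Num.sqrt N%:R.
Proof. by rewrite -(l2norm_phi_sqr k) sqrtr_sqr ger0_norm// l2norm_ge0. Qed.

Lemma FB a c : F x (a - c) = F x a - F x c.
Proof.
rewrite /F /FT -sumrB; apply: eq_bigr => k _.
by rewrite !ffunE scalerBl.
Qed.

Lemma FT_zero_ext (T : {set Gamma}) c : FT x T c = F x (zero_ext T c).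
Proof.
rewrite /F /FT big_mkcond /=; apply: eq_big => [k|k _]; first by rewrite inE.
by rewrite ffunE; case: ifP => // _; rewrite scale0r.
Qed.

Lemma FE a : F x a = \sum_k a k *: phi x k.
Proof. by apply: eq_bigl => k; rewrite inE. Qed.

(** The gradient of the least squares functional vanishes: otherwise
    subtracting the component of the residual along a column of T would
    decrease the residual. *)
Lemma least_squares_orthogonal v (T : {set Gamma}) c (k : Gamma) : (0 < N)%N ->
  is_least_squares x v T c -> k \in T ->
  inner (v - FT x T c) (phi x k) = 0.
Proof.
move=> N0 lsc kT; set r := v - _; set p := phi x k.
have n0 : p != 0 by rewrite -l2norm_eq0 -sqrf_eq0 l2norm_phi_sqr pnatr_eq0 -lt0n.
pose z := inner r p / (l2norm p ^+ 2)%:C%C.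
pose c' := c + [ffun j => if j == k then z else 0].
have := lsc c'.
rewrite -(l2normN (FT x T c - v)) -(l2normN (FT x T c' - v)) !opprB -/r.
have -> : v - FT x T c' = r - z *: p.
  rewrite /r -addrA -opprD; congr (_ - _).
  rewrite /FT (bigD1 k)//= [in RHS](bigD1 k)//= !ffunE eqxx scalerDl.
  rewrite -!addrA; congr (_ + _); rewrite addrC; congr (_ + _).
  by apply: eq_bigr => j /andP[_ /negPf jk]; rewrite !ffunE jk addr0.
rewrite -(@ler_pXn2r _ 2)// ?nnegrE ?l2norm_ge0// l2norm_sub_component//.
rewrite l2norm_phi_sqr lerBrDr gerDl ler_pdivrMr ?ltr0n// mul0r => h.
apply/eqP; rewrite -cmod_eq0 -sqrf_eq0; apply/eqP/le_anti.
by rewrite h sqr_ge0.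
Qed.

Definition l1norm a : R := \sum_k cmod (a k).

Variable mu : R.
Hypothesis mu0 : 0 <= mu.
Hypothesis coherence : forall j k : Gamma, j != k ->
  cmod (inner (phi x j) (phi x k)) <= mu * N%:R.

(** In the expansion of F x a the column k itself contributes N a_k, and every
    other column at most mu N times the modulus of its coefficient. *)
Lemma inner_F_phi a (k : Gamma) :
  cmod (inner (F x a) (phi x k) - N%:R * a k) <=
  mu * N%:R * (l1norm a - cmod (a k)).
Proof.
rewrite FE inner_suml (bigD1 k)//= innerZl inner_phi_self mulrC addrAC subrr add0r.
rewrite (le_trans (cmod_sum _ _))// /l1norm.
rewrite [X in _ <= _ * (X - _)](bigD1 k)//= addrAC subrr add0r mulr_sumr.
apply: ler_sum => j jk; rewrite innerZl cmodM mulrC.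
by rewrite ler_wpM2r ?cmod_ge0 ?coherence.
Qed.

Lemma l1norm_sqr_le a (S : {set Gamma}) : supp a \subset S ->
  l1norm a ^+ 2 <= #|S|%:R * l2norm a ^+ 2.
Proof.
move=> /fintype.subsetP aS.
have l1E : l1norm a = \sum_(k in S) cmod (a k).
  rewrite [RHS]big_mkcond; apply: eq_bigr => k _; case: ifPn => // kS.
  have : k \notin supp a by apply: contra kS => /aS.
  by rewrite inE negbK => /eqP ->; rewrite cmod0.
have l2E : l2norm a ^+ 2 = \sum_(k in S) cmod (a k) ^+ 2.
  rewrite l2norm_sqr [RHS]big_mkcond; apply: eq_bigr => k _; case: ifPn => // kS.
  have : k \notin supp a by apply: contra kS => /aS.
  by rewrite inE negbK => /eqP ->; rewrite cmod0 expr0n.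
have h : \sum_(j in S) \sum_(k in S) (cmod (a j) * cmod (a k)) <=
    \sum_(j in S) \sum_(k in S) ((cmod (a j) ^+ 2 + cmod (a k) ^+ 2) / 2).
  apply: ler_sum => j _; apply: ler_sum => k _.
  by have := sqr_ge0 (cmod (a j) - cmod (a k)); rewrite sqrrB; lra.
rewrite l1E expr2 mulr_suml; under eq_bigr do rewrite mulr_sumr.
rewrite (le_trans h)// le_eqVlt; apply/orP; left; apply/eqP.
transitivity (\sum_(j in S) ((#|S|%:R * cmod (a j) ^+ 2 + l2norm a ^+ 2) / 2)).
  apply: eq_bigr => j _; rewrite -mulr_suml big_split/= sumr_const -l2E.
  by rewrite mulr_natl.
rewrite -mulr_suml big_split/= sumr_const -mulr_sumr -l2E -[_ *+ #|_|]mulr_natl.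
by field.
Qed.

(** Gershgorin's bound: the Gram matrix of M columns is N times a matrix which
    is within (M - 1) mu of the identity. *)
Lemma l2norm_F_ge a (S : {set Gamma}) : supp a \subset S ->
  N%:R * (1 - (#|S|%:R - 1) * mu) * l2norm a ^+ 2 <= l2norm (F x a) ^+ 2.
Proof.
move=> aS.
have -> : l2norm (F x a) ^+ 2 =
    complex.Re (\sum_k a k * (inner (F x a) (phi x k))^*%C).
  rewrite -[LHS]/(complex.Re (l2norm (F x a) ^+ 2)%:C%C) -inner_self {1}FE inner_suml.
  by congr complex.Re; apply: eq_bigr => k _; rewrite innerZl innerC.
rewrite raddf_sum /=.
have h k : N%:R * cmod (a k) ^+ 2 - cmod (a k) * (mu * N%:R * (l1norm a - cmod (a k)))
   <= complex.Re (a k * (inner (F x a) (phi x k))^*%C).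
  set e := inner (F x a) (phi x k) - N%:R * a k.
  have -> : inner (F x a) (phi x k) = N%:R * a k + e by rewrite /e addrC subrK.
  rewrite rmorphD /= rmorphM /= conjc_nat [a k * (_ + _)]mulrDr.
  rewrite [a k * (_ * _)]mulrCA mul_conj raddfD /=.
  have -> : complex.Re (N%:R * (cmod (a k) ^+ 2)%:C%C) = N%:R * cmod (a k) ^+ 2.
    by rewrite -(rmorph_nat (real_complex R)) -rmorphM.
  rewrite lerD2l lerNl -raddfN /= (le_trans (Re_le_cmod _))//.
  rewrite cmodN cmodM cmod_conj ler_wpM2l ?cmod_ge0//; exact: inner_F_phi.
rewrite (le_trans _ (ler_sum _ (fun k _ => h k)))//.
rewrite sumrB -mulr_sumr -l2norm_sqr.
under eq_bigr do rewrite mulrCA mulrBr.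
rewrite -mulr_sumr sumrB -mulr_suml -/(l1norm a) -expr2.
under eq_bigr do rewrite -expr2.
rewrite -l2norm_sqr.
have := ler_wpM2l (mulr_ge0 mu0 (ler0n _ N)) (l1norm_sqr_le aS).
lra.
Qed.
End Greedy.

(** * Recovery from low coherence *)

Section Recovery.
Context (R : realType) (d N : nat) (Gamma : {fset 'rV[int]_d}).
Variables (x : 'I_N -> d.-tuple R) (mu tau sigma : R) (M : nat).
Variables (c : {ffun Gamma -> R[i]}) (eta : {ffun 'I_N -> R[i]}).
Hypothesis N0 : (0 < N)%N.
Hypothesis mu0 : 0 <= mu.
Hypothesis coherence : forall j k : Gamma, j != k ->
  cmod (inner (phi x j) (phi x k)) <= mu * N%:R.
Hypothesis tau01 : 0 < tau < 1.
Hypothesis mu_tau : (2 * M%:R - 1) * mu <= tau.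
Hypothesis sparse : (#|supp c| <= M)%N.
Hypothesis eta_small : l2norm eta <= sigma.
Hypothesis c_large : forall k, k \in supp c ->
  2 * sigma / ((1 - tau) * Num.sqrt N%:R) < cmod (c k).

Local Notation S := (supp c).
Local Notation y := (F x c + eta).
Local Notation err T b := (c - zero_ext T b).

Let N_gt0 : 0 < N%:R :> R. Proof. by rewrite ltr0n. Qed.
Let sqrtN_gt0 : 0 < Num.sqrt N%:R :> R. Proof. by rewrite sqrtr_gt0. Qed.
Let sqrtN_sqr : Num.sqrt N%:R * Num.sqrt N%:R = N%:R :> R.
Proof. by rewrite -expr2 sqr_sqrtr// ler0n. Qed.
Let S_le : #|S|%:R <= M%:R :> R. Proof. by rewrite ler_nat. Qed.
Let sigma0 : 0 <= sigma. Proof. exact: le_trans (l2norm_ge0 _) eta_small. Qed.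

Lemma residualE (T : {set Gamma}) b : y - FT x T b = F x (err T b) + eta.
Proof. by rewrite FT_zero_ext FB addrAC. Qed.

Lemma supp_err (T : {set Gamma}) b : T \subset S -> supp (err T b) \subset S.
Proof.
move=> /fintype.subsetP TS; apply/fintype.subsetP => k; rewrite !inE !ffunE.
case: ifPn => [/TS|_]; first by rewrite inE.
by rewrite subr0.
Qed.

Lemma err_notin (T : {set Gamma}) b k : k \notin T -> err T b k = c k.
Proof. by move=> /negPf kT; rewrite !ffunE kT subr0. Qed.

Lemma cmod_le_l2norm (a : {ffun Gamma -> R[i]}) k : cmod (a k) <= l2norm a.
Proof.
rewrite -(@ler_pXn2r _ 2)// ?nnegrE ?cmod_ge0 ?l2norm_ge0// l2norm_sqr.
by rewrite (bigD1 k)//= lerDl sumr_ge0// => j _; exact: sqr_ge0.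
Qed.

Lemma large_coefficient k : k \in S ->
  2 * sigma < (1 - tau) * Num.sqrt N%:R * cmod (c k).
Proof.
have [_ t1] := andP tau01.
have den0 : 0 < (1 - tau) * Num.sqrt N%:R by rewrite mulr_gt0// subr_gt0.
by move=> /c_large; rewrite ltr_pdivrMr// [ltRHS]mulrC.
Qed.

(** Here (|S| - 1) mu <= tau / 2, because 2 (M - 1) <= 2 M - 1. *)
Lemma l2norm_F_err_ge (T : {set Gamma}) b : T \subset S ->
  N%:R * (1 - tau / 2) * l2norm (err T b) ^+ 2 <= l2norm (F x (err T b)) ^+ 2.
Proof.
move=> TS; rewrite (le_trans _ (l2norm_F_ge mu0 coherence (supp_err b TS)))//.
apply: ler_wpM2r; first exact: sqr_ge0.
apply: ler_wpM2l; first exact: ler0n.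
have := ler_wpM2r mu0 S_le; move: mu0 mu_tau. lra.
Qed.

(** A frequency of S missed by T leaves the whole of its coefficient in the
    error, and the columns of S are too close to orthogonal for its image to
    be hidden by the noise. *)
Lemma residual_large (T : {set Gamma}) b : T \proper S ->
  sigma < l2norm (y - FT x T b).
Proof.
move=> /properP[TS [k kS kT]].
have := l2norm_F_err_ge b TS; rewrite residualE; set a := err T b => Fa.
have ak : cmod (c k) <= l2norm a by rewrite -(err_notin b kT) cmod_le_l2norm.
have [t0 t1] := andP tau01.
have large : 2 * sigma < (1 - tau) * Num.sqrt N%:R * l2norm a.
  rewrite (lt_le_trans (large_coefficient kS))// ler_wpM2l//.
  by rewrite mulr_ge0 ?ltW// subr_gt0.
have large2 : 2 * sigma < l2norm (F x a).
  rewrite (lt_le_trans large)// -(@ler_pXn2r _ 2)// ?nnegrE ?l2norm_ge0//; last first.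
    by rewrite !mulr_ge0 ?l2norm_ge0 ?ltW// subr_gt0.
  rewrite (le_trans _ Fa)// !exprMn sqr_sqrtr ?ler0n//.
  (* what remains is (1 - tau)^2 <= 1 - tau / 2 *)
  rewrite [_ ^+ 2 * N%:R]mulrC ler_wpM2r ?sqr_ge0// ler_wpM2l ?ler0n//.
  by have := mulr_gt0 t0 t0; nra.
have : l2norm (F x a) <= l2norm (F x a + eta) + l2norm eta.
  by rewrite -{1}[F x a](addrK eta) (le_trans (l2normD _ _))// l2normN.
have := eta_small; lra.
Qed.

(** The correlation of the residual with a column is N times the coefficient
    of the error, up to the coherence and the noise. At the largest
    coefficient of the error it beats everything that a column outside S can
    reach, and it does not vanish, as it would on T by the normal equations. *)
Lemma greedy_choice (T : {set Gamma}) b k : T \proper S ->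
  is_least_squares x y T b -> is_argmax x (y - FT x T b) k ->
  k \in S /\ k \notin T.
Proof.
move=> /properP[TS [k0 k0S k0T]] lsb kmax.
have [j jS jmax] : exists2 j, j \in S &
    forall i, i \in S -> cmod (err T b i) <= cmod (err T b j).
  case: (@Order.TotalTheory.arg_maxP _ _ _ k0 (mem S) (fun i => cmod (err T b i)) k0S).
  by move=> j jS jmax; exists j.
have lek := kmax j.
have ortho := least_squares_orthogonal N0 lsb.
move: lek; rewrite residualE in ortho *; set a := err T b in jmax ortho * => lek.
set A := cmod (a j) in jmax.
have aS : supp a \subset S by exact: supp_err.
have A_large : 2 * sigma < (1 - tau) * Num.sqrt N%:R * A.
  rewrite (lt_le_trans (large_coefficient k0S))// ler_wpM2l//.
    by rewrite mulr_ge0 ?ltW// subr_gt0; case/andP: tau01.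
  by rewrite -(err_notin b k0T) jmax.
have A0 : 0 <= A := cmod_ge0 _.
have l1a : l1norm a <= M%:R * A.
  apply: (@le_trans _ _ (#|S|%:R * A)); last exact: ler_wpM2r.
  rewrite mulr_natl -sumr_const [leRHS]big_mkcond; apply: ler_sum => i _.
  case: ifPn => [/jmax//|iS]; suff -> : a i = 0 by rewrite cmod0.
  apply/eqP; apply: contraNT iS => ai; apply: (fintype.subsetP aS).
  by rewrite inE.
have noise i : cmod (inner eta (phi x i)) <= sigma * Num.sqrt N%:R.
  by rewrite (le_trans (CauchySchwarz _ _))// l2norm_phi ler_wpM2r// ltW.
have lower : N%:R * A <= cmod (inner (F x a + eta) (phi x j)) +
    mu * N%:R * (l1norm a - A) + sigma * Num.sqrt N%:R.
  have -> : N%:R * A = cmod (N%:R * a j).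
    rewrite cmodM; congr (_ * _).
    by rewrite -(rmorph_nat (real_complex R)) cmod_real ger0_norm.
  have -> : N%:R * a j = inner (F x a + eta) (phi x j) -
      (inner (F x a) (phi x j) - N%:R * a j) - inner eta (phi x j).
    by rewrite innerDl; ring.
  rewrite (le_trans (cmodD _ _))// cmodN lerD ?noise//.
  rewrite (le_trans (cmodD _ _))// cmodN lerD// inner_F_phi//.
(* the lower bound at j exceeds any upper bound outside S: with at most M
   coefficients, none larger than A, coherence costs at most (2 M - 1) mu N A *)
have gap : mu * N%:R * l1norm a + mu * N%:R * (l1norm a - A) +
    2 * (sigma * Num.sqrt N%:R) < N%:R * A.
  have h1 : 2 * (mu * N%:R) * l1norm a <= 2 * (mu * N%:R) * (M%:R * A).
    by rewrite ler_wpM2l// !mulr_ge0// ltW.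
  have h2 : (2 * M%:R - 1) * mu * (N%:R * A) <= tau * (N%:R * A).
    by rewrite ler_wpM2r// mulr_ge0// ltW.
  have h3 : 2 * sigma * Num.sqrt N%:R < (1 - tau) * (N%:R * A).
    rewrite -{2}sqrtN_sqr; move: A_large; rewrite -(ltr_pM2r sqrtN_gt0); lra.
  lra.
have l10 : 0 <= mu * N%:R * l1norm a.
  by rewrite !mulr_ge0// sumr_ge0// => i _; exact: cmod_ge0.
have sN0 : 0 <= sigma * Num.sqrt N%:R by rewrite mulr_ge0// ltW.
split.
  apply: contraT => kS.
  have ak0 : a k = 0.
    by apply/eqP; apply: contraNT kS => ak; apply: (fintype.subsetP aS); rewrite inE.
  have upper : cmod (inner (F x a + eta) (phi x k)) <=
      mu * N%:R * l1norm a + sigma * Num.sqrt N%:R.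
    rewrite innerDl (le_trans (cmodD _ _))// lerD ?noise//.
    by have := inner_F_phi coherence a k; rewrite ak0 cmod0 mulr0 !subr0.
  by move: lek upper lower gap; lra.
apply/negP => /ortho k0'; move: lek; rewrite k0' cmod0.
by move: lower gap; lra.
Qed.

Lemma residual_small b : is_least_squares x y S b ->
  l2norm (y - FT x S b) <= sigma.
Proof.
move=> lsb; rewrite -l2normN opprB (le_trans (lsb c))// FT_zero_ext.
suff -> : zero_ext S c = c by rewrite opprD addrA subrr add0r l2normN.
apply/ffunP => k; rewrite ffunE inE; case: ifPn => //.
by rewrite negbK => /eqP.
Qed.

(** The image of the error is orthogonal to the residual, which is its sum
    with the noise; so it is no longer than the noise. *)
Lemma l2norm_err_le b : is_least_squares x y S b ->
  l2norm (err S b) <= (Num.sqrt (N%:R * (1 - tau / 2)))^-1 * sigma.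
Proof.
move=> lsb; have := l2norm_F_err_ge b (subxx _).
have ortho := least_squares_orthogonal N0 lsb; rewrite residualE in ortho.
set a := err S b in ortho *.
have aS : supp a \subset S by exact: supp_err.
have r_Fa : inner (F x a) (F x a + eta) = 0.
  rewrite FE inner_suml big1// => k _; rewrite -FE innerZl.
  case: (boolP (k \in S)) => [kS|kS]; first by rewrite innerC ortho// conjc0 mulr0.
  suff -> : a k = 0 by rewrite mul0r.
  by apply/eqP; apply: contraNT kS => ak; apply: (fintype.subsetP aS); rewrite inE.
have Fa_le : l2norm (F x a) <= sigma.
  have [->|Fa0] := eqVneq (F x a) 0.
    by rewrite (eqP (_ : l2norm 0 == 0))// l2norm_eq0.
  have Fa_gt0 : 0 < l2norm (F x a) by rewrite lt_def l2norm_eq0 Fa0 l2norm_ge0.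
  rewrite (le_trans _ eta_small)// -(ler_pM2l Fa_gt0).
  apply: le_trans (CauchySchwarz _ _).
  move/eqP: r_Fa; rewrite innerDr inner_self addrC addr_eq0 => /eqP ->.
  by rewrite cmodN cmod_real ger0_norm ?sqr_ge0// expr2.
have [t0 t1] := andP tau01.
move=> Fa_ge; have K0 : 0 < N%:R * (1 - tau / 2) by rewrite mulr_gt0//; lra.
rewrite mulrC ler_pdivlMr ?sqrtr_gt0//.
rewrite -(@ler_pXn2r _ 2)// ?nnegrE ?mulr_ge0 ?l2norm_ge0 ?sqrtr_ge0//.
rewrite exprMn (sqr_sqrtr (ltW K0)) mulrC (le_trans Fa_ge)//.
by rewrite ler_pXn2r// ?nnegrE ?l2norm_ge0.
Qed.

(** As long as the support is not exhausted the residual exceeds sigma and the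
    next frequency is a new one from S; so the run reaches S after exactly
    #|S| steps. *)
Lemma omp_recovers (T : nat -> {set Gamma}) (b : nat -> {ffun Gamma -> R[i]})
    (r : nat -> {ffun 'I_N -> R[i]}) :
  omp_run x y sigma T b r ->
  exists s : nat,
    [/\ stops_at sigma r s,
        T s = S &
        l2norm (c - zero_ext (T s) (b s)) <=
          (Num.sqrt (N%:R * (1 - tau / 2)))^-1 * sigma].
Proof.
move=> [T0 r0 step].
have inv s : (s <= #|S|)%N ->
    [/\ forall t, (t < s)%N -> sigma < l2norm (r t),
        T s \subset S, #|T s| = s, is_least_squares x y (T s) (b s) &
        r s = y - FT x (T s) (b s)].
  elim: s => [_|s IH sS].
    have FT0 e : FT x (T 0%N) e = 0 by rewrite T0 /FT big_set0.
    split=> //; first by rewrite T0 finset.sub0set.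
    - by rewrite T0 cards0.
    - by move=> e; rewrite !FT0.
    - by rewrite FT0 subr0.
  have [large TS cT ls rE] := IH (ltnW sS).
  have prop : T s \proper S by rewrite properEcard TS cT.
  have large' t : (t < s.+1)%N -> sigma < l2norm (r t).
    rewrite ltnS leq_eqVlt => /orP[/eqP ->|]; last exact: large.
    by rewrite rE; exact: residual_large.
  have [[k kmax Tk] ls' rE'] := step s large'.
  rewrite rE in kmax; have [kS kT] := greedy_choice prop ls kmax.
  split=> //.
    by rewrite Tk finset.subUset finset.sub1set kS.
  by rewrite Tk cardsU1 kT cT.
have [large TS cT ls rE] := inv _ (leqnn _).
have TE : T #|S| = S by apply/eqP; rewrite eqEcard TS cT leqnn.
exists #|S|; rewrite TE in ls rE *; split=> //; last exact: l2norm_err_le.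
by split=> //; rewrite rE; exact: residual_small.
Qed.
End Recovery.

(** * Chernoff's bound by counting *)

Section Chernoff.
Context (R : realType).

(** From exp (- x) >= 1 - x, by taking inverses. *)
Lemma expR_le_quadratic (x : R) : x <= 1 / 2 -> expR x <= 1 + x + 2 * x ^+ 2.
Proof.
move=> x2; have x1 : 0 < 1 - x by lra.
have -> : expR x = (expR (- x))^-1 by rewrite expRN invrK.
apply: (@le_trans _ _ (1 - x)^-1).
  by rewrite lef_pV2 ?posrE ?expR_gt0// expR_ge1Dx.
rewrite -[_^-1]mul1r ler_pdivrMr// -subr_ge0.
have -> : (1 + x + 2 * x ^+ 2) * (1 - x) - 1 = x ^+ 2 * (1 - 2 * x) by ring.
by rewrite mulr_ge0 ?sqr_ge0//; lra.
Qed.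

Context (W : finType) (N : nat).

(** Chernoff's bound for N independent uniform points of W, in counting form:
    the indicator of a large sum is at most the product of the exponentials of
    t / 4 times the summands, and the sum over all N-tuples of this product
    factors. *)
Lemma chernoff_count (h : W -> R) (t : R) :
  0 <= t <= 2 -> (forall w, h w <= 1) -> (forall w, - 1 <= h w) ->
  \sum_w h w = 0 ->
  #|[set v : {ffun 'I_N -> W} | t * N%:R < \sum_i h (v i)]%SET|%:R <=
  (#|W| ^ N)%:R * expR (- (N%:R * (t ^+ 2 / 8))).
Proof.
move=> /andP[t0 t2] h1 hN1 hmean; pose lam := t / 4.
have mgf : \sum_w expR (lam * h w) <= #|W|%:R * expR (t ^+ 2 / 8).
  apply: (@le_trans _ _ (\sum_w (1 + lam * h w + t ^+ 2 / 8))).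
    apply: ler_sum => w _; rewrite (le_trans (expR_le_quadratic _))//.
      by rewrite /lam; have := h1 w; have := hN1 w; nra.
    rewrite lerD2l exprMn /lam.
    (* 2 (t / 4)^2 = t^2 / 8 *)
    have hw : h w ^+ 2 <= 1.
      rewrite -subr_ge0; have -> : 1 - h w ^+ 2 = (1 - h w) * (1 + h w) by ring.
      by rewrite mulr_ge0//; [have := h1 w|have := hN1 w]; lra.
    have : t ^+ 2 * h w ^+ 2 <= t ^+ 2 by rewrite ler_piMr// sqr_ge0.
    by lra.
  rewrite !big_split /= -mulr_sumr hmean mulr0 addr0 -big_split /= sumr_const.
  by rewrite -[leLHS]mulr_natl ler_wpM2l// expR_ge1Dx.
apply: (@le_trans _ _ (\sum_(v : {ffun 'I_N -> W})
    expR (- (lam * (t * N%:R))) * \prod_i expR (lam * h (v i)))).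
  rewrite -sum1_card natr_sum big_mkcond /=; apply: ler_sum => v _.
  rewrite -expR_sum -expRD -mulr_sumr inE.
  case: ifPn => [tv|_]; last exact: expR_ge0.
  by rewrite -[leLHS]expR0 ler_expR addrC -mulrBr mulr_ge0 /lam; lra.
rewrite -mulr_sumr -(bigA_distr_bigA (fun _ w => expR (lam * h w))) /=.
rewrite prodr_const card_ord.
apply: (@le_trans _ _ (expR (- (lam * (t * N%:R))) *
    (#|W|%:R * expR (t ^+ 2 / 8)) ^+ N)).
  rewrite ler_wpM2l ?expR_ge0// lerXn2r// nnegrE.
    by apply: sumr_ge0 => w _; exact: expR_ge0.
  by rewrite mulr_ge0// expR_ge0.
rewrite exprMn mulrCA natrX ler_wpM2l ?exprn_ge0// -expRM_natl -expRD ler_expR.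
by rewrite /lam; lra.
Qed.

Lemma chernoff_union (K : finType) (h : K -> W -> R) (t : R) :
  0 <= t <= 2 -> (forall k w, h k w <= 1) -> (forall k w, - 1 <= h k w) ->
  (forall k, \sum_w h k w = 0) ->
  #|[set v : {ffun 'I_N -> W} |
      [exists k, t * N%:R < \sum_i h k (v i)]]%SET|%:R <=
  #|K|%:R * ((#|W| ^ N)%:R * expR (- (N%:R * (t ^+ 2 / 8)))).
Proof.
move=> t02 h1 hN1 hmean.
apply: (@le_trans _ _ (\sum_(k : K)
    #|[set v : {ffun 'I_N -> W} | t * N%:R < \sum_i h k (v i)]%SET|%:R)).
  rewrite -natr_sum ler_nat.
  pose B k := [set v : {ffun 'I_N -> W} | t * N%:R < \sum_i h k (v i)]%SET.
  apply: (@leq_trans #|\bigcup_k B k|%SET).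
    apply/subset_leq_card/fintype.subsetP => v; rewrite inE => /existsP[k kv].
    by apply/finset.bigcupP; exists k => //; rewrite inE.
  elim/big_rec2 : _ => [|k n A _ An]; first by rewrite cards0.
  by rewrite (leq_trans (leq_card_setU _ _))// leq_add2l.
rewrite mulr_natl -sumr_const; apply: ler_sum => k _.
exact: chernoff_count.
Qed.
End Chernoff.

(** * Exponentials on the unit circle *)

Section Characters.
Context (R : realType).

Lemma expi_sum (I : finType) (f : I -> R) :
  expi (\sum_i f i) = \prod_i expi (f i).
Proof. exact: (big_morph _ (@expiD R) (@expi0 R)). Qed.

Lemma expiM_nat (t : R) (n : nat) : expi (t * n%:R) = expi t ^+ n.
Proof.
elim: n => [|n IH]; first by rewrite mulr0 expi0 expr0.
by rewrite -addn1 natrD mulrDr mulr1 expiD IH exprD expr1.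
Qed.

Lemma expi_2pi : expi (2 * pi) = 1 :> R[i].
Proof. by rewrite mulr_natl /expi cos2pi sin2pi. Qed.

Lemma expi_2pi_int (z : int) : expi (z%:~R * (2 * pi)) = 1 :> R[i].
Proof.
case: z => n; rewrite ?NegzE ?mulrNz -pmulrn ?mulNr mulrC ?expiN expiM_nat;
  by rewrite expi_2pi expr1n ?conjc1.
Qed.

(** By cos t = 1 - 2 (sin (t / 2))^2, where |t| / 2 lies between 0 and pi. *)
Lemma expi_neq1 (t : R) : 0 < `|t| < 2 * pi -> expi t != 1.
Proof.
move=> /andP[t0 tpi]; apply/eqP => /(congr1 (@complex.Re R)) /= cos1.
have s0 : 0 < sin (`|t| / 2).
  by apply: sin_gt0_pi; apply/andP; split; lra.
have : cos `|t| = 1 by case: (ger0P t) => _ //; rewrite cosN.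
have -> : `|t| = (`|t| / 2) *+ 2 by rewrite -mulr_natr; field.
rewrite cos_mulr2n; have := cos2Dsin2 (`|t| / 2); have := exprn_gt0 2 s0.
by rewrite -mulr_natr; lra.
Qed.

Lemma cos_sin_lipschitz (s t : R) :
  `|cos s - cos t| <= `|s - t| /\ `|sin s - sin t| <= `|s - t|.
Proof.
wlog st : s t / t <= s => [H|].
  case: (leP t s) => [|/ltW] st; first exact: H.
  by rewrite [ `|cos s - _|]distrC [ `|sin s - _|]distrC [ `|s - t|]distrC; exact: H.
have cc : {within `[t, s], continuous (@cos R)}%classic.
  by apply: continuous_subspaceT => z; exact: continuous_cos.
have cs : {within `[t, s], continuous (@sin R)}%classic.
  by apply: continuous_subspaceT => z; exact: continuous_sin.
split.
  have [c _ ->] := MVT_segment st (fun x _ => is_derive_cos x) cc.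
  by rewrite normrM ler_piMl// normrN sin_max.
have [c _ ->] := MVT_segment st (fun x _ => is_derive_sin x) cs.
by rewrite normrM ler_piMl// cos_max.
Qed.
End Characters.

(** * Characters of the finite grid *)

Section Grid.
Context (R : realType) (d q : nat).
Hypothesis q0 : (0 < q)%N.
Local Notation W := {ffun 'I_d -> 'I_q}.

Definition gridpt (w : W) : d.-tuple R := grid_point R [tuple w i | i < d].

Lemma tnth_gridpt w i : tnth (gridpt w) i = 2 * pi * (w i)%:R / q%:R.
Proof. by rewrite /gridpt /grid_point !tnth_mktuple. Qed.

(** Orthogonality of the characters of (Z/q)^d: the sum is a product of
    geometric sums, and the one along the coordinate i runs over all powers of
    a q-th root of unity other than 1. *)
Lemma grid_character_sum (n : 'rV[int]_d) (i : 'I_d) :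
  n ord0 i != 0 -> `|n ord0 i| < q%:Z ->
  \sum_(w : W) expi (dotp n (gridpt w)) = 0 :> R[i].
Proof.
move=> n0 nq; have q0R : 0 < q%:R :> R by rewrite ltr0n.
transitivity (\sum_(w : W) \prod_j
    expi ((n ord0 j)%:~R * (2 * pi) / q%:R * (w j)%:R) : R[i]).
  apply: eq_bigr => w _; rewrite -expi_sum; congr expi.
  by apply: eq_bigr => j _; rewrite tnth_gridpt; field; rewrite lt0r_neq0.
rewrite -(bigA_distr_bigA
  (fun j (m : 'I_q) => expi ((n ord0 j)%:~R * (2 * pi) / q%:R * m%:R))) /=.
apply/eqP; rewrite prodf_seq_eq0; apply/hasP; exists i; first exact: mem_index_enum.
set t := _ / q%:R; apply/eqP; under eq_bigr do rewrite expiM_nat.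
have t1 : expi t != 1.
  apply: expi_neq1; rewrite /t normrM normfV normrM (ger0_norm (ltW q0R)).
  rewrite (ger0_norm (ltW (two_pi_gt0 R))) -intr_norm.
  have z0 : 0 < `|n ord0 i|%:~R :> R by rewrite ltr0z normr_gt0.
  have zq : `|n ord0 i|%:~R < q%:R :> R by rewrite -[q%:R]/(q%:Z%:~R) ltr_int.
  apply/andP; split; first by rewrite divr_gt0// mulr_gt0// two_pi_gt0.
  by rewrite ltr_pdivrMr// mulrC ltr_pM2l// two_pi_gt0.
have /esym/eqP := subrX1 (expi t) q.
rewrite -expiM_nat [t * _](_ : _ = (n ord0 i)%:~R * (2 * pi)); last first.
  by rewrite /t; field; rewrite lt0r_neq0.
by rewrite expi_2pi_int subrr mulf_eq0 subr_eq0 (negPf t1) => /eqP.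
Qed.

(** The four real functions that control the modulus of a character: sine or
    cosine, with either sign. *)
Definition trig (sb : bool * bool) (t : R) : R :=
  (-1) ^+ sb.1 * (if sb.2 then sin t else cos t).

Lemma trig_bounds sb t : -1 <= trig sb t <= 1.
Proof.
rewrite -ler_norml /trig normrM normrX normrN1 expr1n mul1r.
by case: sb.2; rewrite ?sin_max ?cos_max.
Qed.

Lemma trig_lipschitz sb (s t : R) : trig sb s <= trig sb t + `|s - t|.
Proof.
rewrite -lerBlDl /trig -mulrBr (le_trans (ler_norm _))//.
rewrite normrM normrX normrN1 expr1n mul1r.
by have [] := cos_sin_lipschitz s t; case: sb.2.
Qed.

Lemma trig_mean (n : 'rV[int]_d) (i : 'I_d) sb :
  n ord0 i != 0 -> `|n ord0 i| < q%:Z ->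
  \sum_(w : W) trig sb (dotp n (gridpt w)) = 0.
Proof.
move=> n0 nq; rewrite -mulr_sumr; have h := grid_character_sum n0 nq.
suff -> : \sum_(w : W) (if sb.2 then sin (dotp n (gridpt w))
    else cos (dotp n (gridpt w))) = 0.
  by rewrite mulr0.
case: sb.2.
  transitivity (complex.Im (\sum_(w : W) expi (dotp n (gridpt w)) : R[i])).
    by rewrite raddf_sum.
  by rewrite h.
transitivity (complex.Re (\sum_(w : W) expi (dotp n (gridpt w)) : R[i])).
  by rewrite raddf_sum.
by rewrite h.
Qed.

Lemma cmod_sum_expi_le (N : nat) (th : 'I_N -> R) (B : R) :
  (forall sb, \sum_l trig sb (th l) <= B) ->
  cmod (\sum_l expi (th l)) <= 2 * B.
Proof.
move=> trigB.
have sumE b : `|\sum_l (if b then sin (th l) else cos (th l))| <= B.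
  rewrite ler_norml lerNl -mulN1r.
  have := trigB (true, b); have := trigB (false, b).
  by rewrite /trig /= -!mulr_sumr expr0 expr1 mul1r => -> ->.
rewrite [2 * B]mulr_natl mulr2n.
have -> : \sum_l expi (th l) =
    ((\sum_l cos (th l))%:C + 'i * (\sum_l sin (th l))%:C)%C.
  rewrite !rmorph_sum /= mulr_sumr -big_split /=; apply: eq_bigr => l _.
  by rewrite /expi; simpc.
rewrite (le_trans (cmodD _ _))// cmodM !cmod_real.
have -> : cmod 'i%C = 1 :> R by rewrite /cmod /= expr0n /= add0r expr1n sqrtr1.
by rewrite mul1r lerD// ?(sumE false) ?(sumE true).
Qed.

Lemma dotp_close (n : 'rV[int]_d) (z z' : d.-tuple R) (delta : R) :
  (forall i, `|tnth z i - tnth z' i| <= delta) ->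
  `|dotp n z - dotp n z'| <= (\sum_i `|n ord0 i|%:~R) * delta.
Proof.
move=> zz'; rewrite /dotp -sumrB (le_trans (ler_norm_sum _ _ _))// mulr_suml.
apply: ler_sum => i _; rewrite -mulrBr normrM -intr_norm.
by rewrite ler_wpM2l// ler0z.
Qed.
End Grid.

(** * From boxes to probabilities *)

Section Cells.
Local Open Scope classical_set_scope.
Context (disp : measure_display) (Omega : measurableType disp) (R : realType).
Context (P : probability Omega R) (d q N : nat).
Variable X : 'I_N -> {RV P >-> d.-tuple R}.
Local Notation W := {ffun 'I_d -> 'I_q}.
Variable I : 'I_q -> set R.

Definition box (w : W) : set (d.-tuple R) :=
  [set z | forall i, I (w i) (tnth z i)].

(** Both probability models are instances of this one: the cells are points of
    the grid in the discrete model, and short intervals that start at points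
    of the grid in the continuous one. *)
Definition uniform_on_boxes (delta : R) : Prop :=
  [/\ forall m, measurable (I m),
      forall m m' t, I m t -> I m' t -> m = m',
      forall (m : 'I_q) t, I m t -> `|t - 2 * pi * m%:R / q%:R| <= delta,
      independent_RVs X &
      forall l w, P (X l @^-1` box w) = ((q ^ d)%:R^-1)%:E].

Hypothesis mI : forall m, measurable (I m).
Hypothesis disjI : forall m m' t, I m t -> I m' t -> m = m'.

Lemma measurable_box w : measurable (box w).
Proof.
have -> : box w = \bigcap_(i in [set: 'I_d]) ((fun z => tnth z i) @^-1` I (w i)).
  by apply/seteqP; split => z h i; [move=> _|]; exact: h.
apply: fin_bigcap_measurable => // i _; rewrite -[X in measurable X]setTI.
exact: measurable_tnth.
Qed.

Lemma box_inj w w' z : box w z -> box w' z -> w = w'.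
Proof. by move=> h h'; apply/ffunP => i; exact: disjI (h i) (h' i). Qed.

Hypothesis indepX : independent_RVs X.
Hypothesis unifX : forall l w, P (X l @^-1` box w) = ((q ^ d)%:R^-1)%:E.

Definition box_event (G : {set {ffun 'I_N -> W}}) : set Omega :=
  \bigcup_(v in [set` G]) \bigcap_(l in [set: 'I_N]) (X l @^-1` box (v l)).

Let mboxes v : measurable (\bigcap_(l in [set: 'I_N]) (X l @^-1` box (v l))).
Proof.
apply: fin_bigcap_measurable => // l _; rewrite -[X in measurable X]setTI.
exact: (measurable_funPT (X l)) _ _ (measurable_box _).
Qed.

Lemma measurable_box_event G : measurable (box_event G).
Proof. by apply: fin_bigcup_measurable => // v _; exact: mboxes. Qed.

Lemma prob_box_event G :
  P (box_event G) = (#|G|%:R / ((q ^ d) ^ N)%:R)%:E.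
Proof.
rewrite /box_event measure_fin_bigcup//; last first.
  move=> v v' _ _ [omega [h h']]; apply/ffunP => l.
  exact: box_inj (h l Logic.I) (h' l Logic.I).
rewrite -(@bigfs _ _ _ _ (index_enum {ffun 'I_N -> W}))//; last 2 first.
- exact: index_enum_uniq.
- by move=> v _; rewrite mem_index_enum.
rewrite (eq_bigr (fun=> (((q ^ d) ^ N)%:R^-1)%:E)).
  by rewrite sumEFin sumr_const mulr_natl.
move=> v _; have := indepX [set: 'I_N]%SET (fun l => measurable_box (v l)).
rewrite (_ : [set` _] = setT); last by apply/seteqP; split => // l _ /=; rewrite inE.
move=> indep; apply: (etrans indep).
rewrite (eq_bigr (fun=> ((q ^ d)%:R^-1)%:E)) => [|l _]; last exact: unifX.
rewrite -(big_morph EFin (@EFinM R) erefl) prodr_const cardsT card_ord exprVn.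
by rewrite -natrX.
Qed.
End Cells.

(** * Exponential sums at random points *)

Section Coherence.
Context (disp : measure_display) (Omega : measurableType disp) (R : realType).
Context (P : probability Omega R) (d N : nat) (Gamma : {fset 'rV[int]_d}).
Variable X : 'I_N -> {RV P >-> d.-tuple R}.
Local Notation D := (difference_set Gamma).

Lemma difference_setP n : n \in D ->
  exists j k, [/\ j \in Gamma, k \in Gamma, n = j - k & exists i, n ord0 i != 0].
Proof.
case/imfset2P => /= j jG [k]; rewrite !inE => /andP[kG jk] nE.
exists j, k; split => //; apply/existsP; apply: contraNT jk.
rewrite negb_exists => /forallP n0; rewrite -subr_eq0 -nE.
by apply/eqP/rowP => i; rewrite mxE; apply/eqP; have := n0 i; rewrite negbK.
Qed.

Lemma mem_difference_set (j k : Gamma) : j != k -> val j - val k \in D.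
Proof.
move=> jk; apply/imfset2P; exists (val j); first exact: valP.
by exists (val k) => //; rewrite !inE (valP k).
Qed.

(** The exponential sums along the differences are small at the grid points of
    all but a fraction eps of the choices of N boxes, by Chernoff's bound for
    the 4 |D| sums of sines and cosines; and rounding to the grid moves each
    term by at most u. *)
Lemma exponential_sums_small (q : nat) (I : 'I_q -> set R) (delta u eps : R) :
  (0 < q)%N -> 0 < u <= 2 -> 0 < eps ->
  uniform_on_boxes X I delta ->
  (forall n, n \in D -> forall i, `|n ord0 i| < q%:Z) ->
  (forall n, n \in D -> (\sum_i `|n ord0 i|%:~R) * delta <= u) ->
  8 * u ^- 2 * ln (4 * #|` D|%:R / eps) <= N%:R ->
  with_probability_at_least P (1 - eps) (fun omega =>
    forall n, n \in D ->
    cmod (\sum_l expi (dotp n (X l omega))) <= 4 * u * N%:R).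
Proof.
move=> q0 /andP[u0 u2] eps0 [mI disjI closeI indepX unifX] Dq Ddelta hN.
pose W := {ffun 'I_d -> 'I_q}.
pose h (k : D * (bool * bool)) (w : W) := trig k.2 (dotp (val k.1) (gridpt R w)).
pose bad := [set v : {ffun 'I_N -> W} | [exists k, u * N%:R < \sum_l h k (v l)]]%SET.
have bad_le : #|bad|%:R <= eps * ((q ^ d) ^ N)%:R.
  have cW : #|{: W}| = (q ^ d)%N by rewrite card_ffun !card_ord.
  have := @chernoff_union R W N _ h u.
  rewrite ltW// u2 cW => /(_ isT) ch.
  apply: (le_trans (ch _ _ _)).
  - by move=> k w; have /andP[] := trig_bounds k.2 (dotp (val k.1) (gridpt R w)).
  - by move=> k w; have /andP[] := trig_bounds k.2 (dotp (val k.1) (gridpt R w)).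
  - move=> k; have kD := valP k.1; have [_ [_ [_ _ _ [i ni]]]] := difference_setP kD.
    exact: trig_mean ni (Dq _ kD i).
  rewrite mulrCA mulrC ler_wpM2r// !card_prod card_bool -cardfE.
  have [->|D0] := eqVneq #|` D| 0%N; first by rewrite mul0n mul0r ltW.
  have D0R : 0 < #|` D|%:R :> R by rewrite ltr0n lt0n.
  have L0 : 0 < 4 * #|` D|%:R / eps by rewrite divr_gt0// mulr_gt0.
  have : expR (- (N%:R * (u ^+ 2 / 8))) <= eps / (4 * #|` D|%:R).
    rewrite -[leRHS]invf_div -[X in _ <= X^-1]lnK ?posrE// -expRN ler_expR lerN2.
    have u20 : 0 < u ^+ 2 by rewrite exprn_gt0.
    rewrite [leLHS](_ : _ = 8 * u ^- 2 * ln (4 * #|` D|%:R / eps) * (u ^+ 2 / 8)).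
      by rewrite ler_wpM2r// divr_ge0// ltW.
    by field; rewrite gt_eqF.
  move=> e; rewrite natrM (le_trans (ler_wpM2l _ e))//.
  by rewrite le_eqVlt; apply/orP; left; apply/eqP; field; rewrite gt_eqF.
exists (box_event X I (~: bad)%SET); split.
- exact: measurable_box_event.
- rewrite prob_box_event// lee_fin ler_pdivlMr; last by rewrite ltr0n !expn_gt0 q0.
  have : (#|bad| + #|~: bad|%SET)%:R = ((q ^ d) ^ N)%:R :> R.
    by rewrite cardsC !card_ffun !card_ord.
  by rewrite natrD; lra.
move=> omega [v /= vgood vX] n nD.
rewrite [4 * u * _](_ : _ = 2 * (2 * (u * N%:R))); last by ring.
apply: cmod_sum_expi_le => sb.
apply: (@le_trans _ _ (\sum_l (trig sb (dotp n (gridpt R (v l))) + u))).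
  apply: ler_sum => l _.
  rewrite (le_trans (trig_lipschitz _ _ (dotp n (gridpt R (v l)))))// lerD2l.
  apply: le_trans (Ddelta n nD); apply: dotp_close => i.
  by rewrite tnth_gridpt; apply: closeI; exact: vX.
rewrite big_split /= sumr_const card_ord -[u *+ _]mulr_natr [2 * _]mulr_natl.
rewrite mulr2n lerD2r.
move: vgood; rewrite !inE negb_exists => /forallP/(_ ([` nD]%fset, sb)).
by rewrite -leNgt.
Qed.

Lemma discrete_model_boxes : discrete_model Gamma X ->
  exists2 q, (0 < q)%N & exists2 I : 'I_q -> set R, uniform_on_boxes X I 0 &
    forall n, n \in D -> forall i, `|n ord0 i| < q%:Z.
Proof.
move=> [q [q0 Gq indepX unifX]]; exists q => //.
have q0R : 0 < q%:R :> R by rewrite ltr0n.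
exists (fun m : 'I_q => [set (2 * pi * m%:R / q%:R)]%classic).
  split => //.
  - move=> m m' t /= -> /(mulIf (invr_neq0 (lt0r_neq0 q0R))).
    move=> /(mulfI (lt0r_neq0 (two_pi_gt0 R))) /eqP.
    by rewrite eqr_nat => /eqP/val_inj.
  - by move=> m t /= ->; rewrite subrr normr0.
  - move=> l w; rewrite -(unifX l [tuple w i | i < d]); congr (P (_ @^-1` _)%classic).
    apply/seteqP; split => z /=.
      by move=> h; apply: eq_from_tnth => i; rewrite h !tnth_mktuple.
    by move=> -> i; rewrite !tnth_mktuple.
move=> n /difference_setP[j [k [jG kG -> _]]] i; rewrite !mxE.
have /andP[j0 jq] := Gq j jG i; have /andP[k0 kq] := Gq k kG i.
rewrite ltr_norml; apply/andP; split.
  by rewrite ltrBrDr (lt_le_trans _ j0)// addrC subr_lt0.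
by rewrite ltrBlDr (lt_le_trans jq)// lerDl.
Qed.

Lemma uniform_prob_cell (q m : nat) : (m < q)%N ->
  uniform_prob (two_pi_gt0 R)
    `[2 * pi * m%:R / q%:R, 2 * pi * m.+1%:R / q%:R[%classic = (q%:R^-1)%:E.
Proof.
move=> mq; have q0R : 0 < q%:R :> R by rewrite ltr0n (leq_ltn_trans _ mq).
have p0 := two_pi_gt0 R.
have ab : 2 * pi * m%:R / q%:R < 2 * pi * m.+1%:R / q%:R :> R.
  by rewrite ltr_pM2r ?invr_gt0// ltr_pM2l// ltr_nat.
rewrite /uniform_prob (eq_integral (fun=> ((2 * pi)^-1)%:E)).
  rewrite integral_cst//= lebesgue_measure_itv/= lte_fin ab -EFinD -EFinM.
  congr EFin; rewrite -natr1; move: (pi_gt0 R); move: (@pi R) => p pi0.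
  by field; rewrite !gt_eqF.
move=> t; rewrite inE/= in_itv/= => /andP[t1 t2].
rewrite /uniform_pdf subr0 ifT//; apply/andP; split.
  by rewrite (le_trans _ t1)// !mulr_ge0// ?invr_ge0 ?ltW// pi_gt0.
rewrite ltW// (lt_le_trans t2)// ler_pdivrMr// ler_pM2l//.
by rewrite ler_nat.
Qed.

(** Half-open cells keep the boxes disjoint without changing their measure. *)
Lemma continuous_model_boxes (q : nat) : (0 < q)%N -> continuous_model X ->
  exists I : 'I_q -> set R, uniform_on_boxes X I (2 * pi / q%:R).
Proof.
move=> q0 [indepX unifX].
have q0R : 0 < q%:R :> R by rewrite ltr0n.
have p0 := two_pi_gt0 R.
exists (fun m : 'I_q => `[2 * pi * m%:R / q%:R, 2 * pi * m.+1%:R / q%:R[%classic).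
split => //.
- move=> m m' t /=; rewrite !in_itv/= => /andP[t1 t2] /andP[t3 t4].
  have lt1 (a b : 'I_q) : 2 * pi * a%:R / q%:R <= t ->
      t < 2 * pi * b.+1%:R / q%:R -> (a <= b)%N.
    move=> ta tb; rewrite -ltnS -(ltr_nat R).
    by rewrite -(ltr_pM2l p0) -(@ltr_pM2r _ q%:R^-1) ?invr_gt0// (le_lt_trans ta).
  by apply/val_inj/eqP; rewrite eqn_leq !lt1.
- move=> m t /=; rewrite in_itv/= => /andP[t1 t2].
  rewrite ger0_norm ?subr_ge0// lerBlDl (le_trans (ltW t2))//.
  by rewrite -[m.+1%:R]natr1 mulrDr mulr1 mulrDl.
move=> l w; have := unifX l (fun i =>
  `[2 * pi * (w i)%:R / q%:R, 2 * pi * (w i).+1%:R / q%:R[%classic)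
  (fun i => measurable_itv _).
move=> ->.
rewrite (eq_bigr (fun=> (q%:R^-1)%:E)) => [|i _]; last exact: uniform_prob_cell.
by rewrite -(big_morph EFin (@EFinM R) erefl) prodr_const card_ord exprVn -natrX.
Qed.

Lemma model_exponential_sums_small (u eps : R) :
  0 < u <= 2 -> 0 < eps ->
  continuous_model X \/ discrete_model Gamma X ->
  8 * u ^- 2 * ln (4 * #|` D|%:R / eps) <= N%:R ->
  with_probability_at_least P (1 - eps) (fun omega =>
    forall n, n \in D ->
    cmod (\sum_l expi (dotp n (X l omega))) <= 4 * u * N%:R).
Proof.
move=> u02 eps0 [cX|dX] hN; have [u0 _] := andP u02; last first.
  have [q q0 [I unifI Dq]] := discrete_model_boxes dX.
  apply: (exponential_sums_small q0 u02 eps0 unifI Dq) => // n _.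
  by rewrite mulr0 ltW.
pose S : R := \sum_(n : D) \sum_i `|(val n) ord0 i|%:~R.
have absS n (nD : n \in D) : \sum_i `|n ord0 i|%:~R <= S.
  rewrite /S (bigD1 [` nD]%fset)//= lerDl !sumr_ge0// => m _.
  by rewrite sumr_ge0// => i _; rewrite ler0z.
have S0 : 0 <= S by do 2 (apply: sumr_ge0 => ? _); rewrite ler0z.
(* a grid finer than B has q > |n_i|, and 2 pi S / q <= u *)
pose B := S + S * (2 * pi) / u.
have SB0 : 0 <= S * (2 * pi) / u.
  by rewrite (divr_ge0 _ (ltW u0))// (mulr_ge0 S0 (ltW (two_pi_gt0 R))).
have B0 : 0 <= B by rewrite addr_ge0.
pose q := (Num.bound B).+1.
have Bq : B < q%:R.
  by rewrite (lt_trans (archi_boundP B0))// ltr_nat.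
have q0R : 0 < q%:R :> R by rewrite ltr0n.
have [I unifI] := @continuous_model_boxes q isT cX.
apply: (exponential_sums_small _ u02 eps0 unifI) => // n nD; have nS := absS n nD.
  move=> i; rewrite -(ltr_int R) (le_lt_trans _ Bq)//.
  rewrite (le_trans _ (_ : S <= B)) ?lerDl// (le_trans _ nS)//.
  by rewrite (bigD1 i)//= lerDl sumr_ge0// => j _; rewrite ler0z.
apply: (@le_trans _ _ (S * (2 * pi / q%:R))).
  by rewrite ler_wpM2r// divr_ge0// ltW// two_pi_gt0.
rewrite mulrA ler_pdivrMr// [u * _]mulrC -ler_pdivrMr//.
by rewrite (le_trans _ (ltW Bq))// lerDr.
Qed.
End Coherence.

(** * Recovery with high probability *)

Theorem theorem4p2 (R : realType) :
  exists C : R, 0 < C /\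
  forall (d M N : nat) (Gamma : {fset 'rV[int]_d})
    (disp : measure_display) (Omega : measurableType disp)
    (P : probability Omega R) (X : 'I_N -> {RV P >-> d.-tuple R})
    (tau eps sigma : R),
  (0 < N)%N ->
  continuous_model X \/ discrete_model Gamma X ->
  0 < tau < 1 -> 0 < eps < 1 -> 0 < sigma ->
  C * tau ^- 2 * (2 * M%:R - 1) ^+ 2 *
    ln (4 * #|` difference_set Gamma|%:R / eps) <= N%:R ->
  with_probability_at_least P (1 - eps) (fun omega =>
    let x := fun l => X l omega in
    forall (f : d.-tuple R -> R[i]) (c : {ffun Gamma -> R[i]}),
    sparse_trigpoly M f c ->
    (forall k, k \in supp c ->
       2 * sigma / ((1 - tau) * Num.sqrt N%:R) < cmod (c k)) ->
    forall eta : {ffun 'I_N -> R[i]}, l2norm eta <= sigma ->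
    forall (T : nat -> {set Gamma}) (b : nat -> {ffun Gamma -> R[i]})
      (r : nat -> {ffun 'I_N -> R[i]}),
    omp_run x (F x c + eta) sigma T b r ->
    exists s : nat,
      [/\ stops_at sigma r s,
          T s = supp c &
          l2norm (c - zero_ext (T s) (b s)) <=
            (Num.sqrt (N%:R * (1 - tau / 2)))^-1 * sigma]).
Proof.
exists 128; split; first by rewrite ltr0n.
move=> d M N Gamma disp Omega P X tau eps sigma N0 model tau01 eps01 sigma0 hN.
have [t0 t1] := andP tau01; have [e0 e1] := andP eps01.
(* 2 M - 1 is negative for M = 0 *)
pose m : R := `|2 * M%:R - 1|.
have m1 : 1 <= m.
  rewrite /m; case: (M) => [|k]; first by rewrite mulr0 sub0r normrN1.
  have k0 : 0 <= k%:R :> R by rewrite ler0n.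
  by rewrite (le_trans _ (ler_norm _))// -[k.+1%:R]natr1; lra.
have m0 : 0 < m by lra.
(* 4 u = 2 (u + u): deviation on the grid and rounding, doubled in passing from
   real and imaginary parts to the modulus; 8 u^-2 = 128 tau^-2 (2 M - 1)^2 *)
pose u := tau / (4 * m).
have u0 : 0 < u by rewrite divr_gt0// mulr_gt0.
have u2 : u <= 2 by rewrite ler_pdivrMr ?mulr_gt0//; lra.
have hNu : 8 * u ^- 2 * ln (4 * #|` difference_set Gamma|%:R / eps) <= N%:R.
  apply: le_trans hN; rewrite -(real_normK (num_real (2 * M%:R - 1))) -/m.
  rewrite le_eqVlt; apply/orP; left; apply/eqP; congr (_ * _).
  by rewrite /u; field; rewrite !gt_eqF.
have u02 : 0 < u <= 2 by rewrite u0 u2.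
have [A [mA PA sA]] := model_exponential_sums_small u02 e0 model hNu.
exists A; split => // omega /sA small x f c [[S [SM cS]] _] c_large.
move=> eta eta_small T b r.
apply: (@omp_recovers R d N Gamma x (4 * u) tau sigma M) => //.
- by rewrite mulr_ge0// ltW.
- move=> j k jk; rewrite inner_phi; apply: small; exact: mem_difference_set.
- apply: (@le_trans _ _ (m * (4 * u))).
    by rewrite ler_wpM2r ?ler_norm// mulr_ge0// ltW.
  by rewrite le_eqVlt; apply/orP; left; apply/eqP; rewrite /u; field; rewrite gt_eqF.
- by rewrite (leq_trans (subset_leq_card cS)).
Qed.
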